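(* An element $c=(x_0,x_1,x_2,a_1,a_2,a_{12})\in T_3$ (with $x_0=0$) is singular if and only if all points and all slopes coincide, that is, $x_0=x_1=x_2$ and $a_1=a_2=a_{12}$. The type of this singularity is $A_\infty$.
   Context: $T_3$, the triangle variety for three points, is the zero set in $\mathbb{R}^5$, with coordinates $(x_1,x_2,a_1,a_2,a_{12})$ (and $x_0=0$ fixed by normalization), of the polynomial $t_{12}=a_1x_1-a_2x_2-a_{12}x_1+a_{12}x_2$. It has dimension $4$. Here $x_i$ represents the $x$-coordinate of a point $p_i$ (with $p_0=(0,0)$), $a_i$ the slope of the line through $p_0$ and $p_i$, and $a_{12}$ the slope of the line through $p_1$ and $p_2$. A point of $T_3$ is nonsingular if the rank of the Jacobian matrix of the defining polynomial at that point equals $5-4=1$, and singular otherwise. A hypersurface singularity is of type $A_\infty$ if in suitable local coordinates the defining function is a nondegenerate quadratic form in all but one of the variables (so that the singular locus is a smooth curve). *)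

(* Defs.v *)
From mathcomp Require Import all_boot all_order all_algebra.
From mathcomp Require Import boolp classical_sets reals topology normedtype derive.
Set Implicit Arguments.
Unset Strict Implicit.
Unset Printing Implicit Defensive.
Import Order.TTheory GRing.Theory Num.Theory.
Import numFieldNormedType.Exports.
Local Open Scope classical_set_scope.
Local Open Scope ring_scope.

(* The coordinates of R^5 are (x_1, x_2, a_1, a_2, a_12); x_0 is normalized
   to 0 and is not a coordinate. *)
Section Coordinates.
Context {R : realType}.
Implicit Type c : 'rV[R]_5.

Definition x0 c : R := 0.
Definition x1 c : R := c ord0 (@Ordinal 5 0 isT).
Definition x2 c : R := c ord0 (@Ordinal 5 1 isT).
Definition a1 c : R := c ord0 (@Ordinal 5 2 isT).
Definition a2 c : R := c ord0 (@Ordinal 5 3 isT).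
Definition a12 c : R := c ord0 (@Ordinal 5 4 isT).

Definition t12 c : R := a1 c * x1 c - a2 c * x2 c - a12 c * x1 c + a12 c * x2 c.

End Coordinates.

Definition T3 (R : realType) : set 'rV[R]_5 := [set c | t12 c = 0].

Definition T3_equations (R : realType) (c : 'rV[R]_5) : 'rV[R]_1 :=
  \row_(j < 1) t12 c.

(* For a variety of dimension d in R^n defined by the m equations F = 0.  The
   library's 'J F p is n x m, the transpose of the usual Jacobian matrix. *)
Definition nonsingular_point (R : realType) (n m : nat)
    (F : 'rV[R]_n -> 'rV[R]_m) (d : nat) (p : 'rV[R]_n) : Prop :=
  \rank ('J F p) = (n - d)%N.

Definition T3_singular (R : realType) (c : 'rV[R]_5) : Prop :=
  T3 c /\ ~ nonsingular_point (@T3_equations R) 4 c.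

(* Meaningful for U open: the value of a partial derivative at a point of U
   then depends only on the restriction of f to U. *)
Fixpoint C_on (R : realType) (n : nat) (k : nat) (U : set 'rV[R]_n)
    (f : 'rV[R]_n -> R) : Prop :=
  (forall x, U x -> {for x, continuous f}) /\
  (if k is k'.+1 then
     forall i : 'I_n,
       (forall x, U x -> derivable f x (delta_mx ord0 i)) /\
       C_on k' U (fun x => 'D_(delta_mx ord0 i) f x)
   else True).

Definition smooth_on (R : realType) (n m : nat) (U : set 'rV[R]_n)
    (F : 'rV[R]_n -> 'rV[R]_m) : Prop :=
  forall (k : nat) (j : 'I_m), C_on k U (fun x => F x ord0 j).

(* phi restricts to a smooth diffeomorphism from an open neighbourhood U of p
   onto an open set, with phi p = 0. *)
Definition local_coordinates (R : realType) (n : nat) (p : 'rV[R]_n)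
    (U : set 'rV[R]_n) (phi : 'rV[R]_n -> 'rV[R]_n) : Prop :=
  exists (V : set 'rV[R]_n) (psi : 'rV[R]_n -> 'rV[R]_n),
    [/\ open U, U p & open V] /\
    phi p = 0 /\
    (forall x, U x -> V (phi x) /\ psi (phi x) = x) /\
    (forall y, V y -> U (psi y) /\ phi (psi y) = y) /\
    smooth_on U phi /\ smooth_on V psi.

Definition quadratic_form (R : realType) (n : nat) (Q : 'M[R]_n)
    (y : 'rV[R]_n) : R := (y *m Q *m y^T) ord0 ord0.

(* col' k y is y with its k-th coordinate removed, so the normal form of f does
   not involve the k-th local coordinate. *)
Definition A_infty (R : realType) (n : nat) (f : 'rV[R]_n.+1 -> R)
    (p : 'rV[R]_n.+1) : Prop :=
  exists (U : set 'rV[R]_n.+1) (phi : 'rV[R]_n.+1 -> 'rV[R]_n.+1)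
         (k : 'I_n.+1) (Q : 'M[R]_n),
    [/\ local_coordinates p U phi,
        Q^T = Q,
        Q \in unitmx
      & forall x, U x -> f x = quadratic_form Q (col' k (phi x))].

(* Main.v *)
(* The gradient of t_12 is (a_1 - a_12, a_12 - a_2, x_1, - x_2, x_2 - x_1), whose
   vanishing is the coincidence of all points and all slopes.  The identity
     t_12 = x_1 (a_1 - a_12) - x_2 (a_2 - a_12)
   shows that x_1, x_2, a_1 - a_12, a_2 - a_12 and a_12, centred at the singular
   point, are local coordinates (even global, affine ones) in which t_12 is a
   nondegenerate quadratic form in the first four. *)
From HB Require Import structures.
Require Import Defs.
From mathcomp Require Import all_boot all_order all_algebra.
From mathcomp Require Import boolp classical_sets reals topology normedtype derive.
From mathcomp Require Import functions filter ring lra.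
Set Implicit Arguments.
Unset Strict Implicit.
Unset Printing Implicit Defensive.
Import Order.TTheory GRing.Theory Num.Theory.
Import numFieldNormedType.Exports.
Local Open Scope classical_set_scope.
Local Open Scope ring_scope.

(** The difference quotient equals [d] for every nonzero [h], so its limit is that of a constant. *)
Lemma is_derive_affine (R : realType) (V : normedModType R) (f : V -> R)
    (x v : V) (d : R) :
  (forall t, f (t *: v + x) = t * d + f x) -> is_derive x v f d.
Proof.
move=> fE.
have lim : (fun h => h^-1 *: (f (h *: v + x) - f x)) @ 0^' --> d.
  apply: (@cvg_trans _ (cst d @ 0^')); last exact: cvg_cst.
  apply: near_eq_cvg; near=> h => /=.
  by rewrite fE addrK /GRing.scale /= mulKf //; near: h; exact: nbhs_dnbhs_neq.
split; first by apply/cvg_ex; exists d.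
exact: cvg_lim.
Unshelve. all: by end_near. Qed.

(** Since [d] depends on [v] but not on [x], each partial derivative is a constant function, which
    satisfies the same hypotheses with [d] equal to 0; induction on [k] closes. *)
Lemma C_on_affine (R : realType) (n k : nat) (U : set 'rV[R]_n)
    (f : 'rV[R]_n -> R) :
  continuous f ->
  (forall v, exists d, forall x t, f (t *: v + x) = t * d + f x) ->
  C_on k U f.
Proof.
elim: k f => [|k IHk] f cf fE /=; first by split=> // x _; exact: cf.
split=> [x _|i]; first exact: cf.
have [d dE] := fE (delta_mx ord0 i).
have fD x : is_derive x (delta_mx ord0 i) f d by exact: is_derive_affine.
split=> [x _|]; first exact: ex_derive.
rewrite (_ : (fun x => 'D_(delta_mx ord0 i) f x) = cst d); last first.
  by apply/funext => x; exact: derive_val.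
apply: IHk => [|v]; first exact: cst_continuous.
by exists 0 => x t; rewrite mulr0 add0r.
Qed.

Lemma coord_mulmx_continuous (R : realType) (n m : nat) (P : 'M[R]_(n, m))
    (j : 'I_m) : continuous (fun x : 'rV[R]_n => (x *m P) ord0 j).
Proof.
rewrite (_ : (fun _ => _) = fun x : 'rV[R]_n => \sum_i x ord0 i * P i j).
  apply: continuous_big => [|i _ x]; first exact: add_continuous.
  by apply: cvgMr_tmp; [exact: nbhs_filter | exact: coord_continuous].
by apply/funext => x; rewrite mxE.
Qed.

Lemma smooth_on_affine (R : realType) (n m : nat) (U : set 'rV[R]_n)
    (P : 'M[R]_(n, m)) (b : 'rV[R]_m) : smooth_on U (fun x => x *m P + b).
Proof.
move=> k j.
rewrite (_ : (fun _ => _) = fun x => (x *m P) ord0 j + b ord0 j); last first.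
  by apply/funext => x; rewrite mxE.
apply: C_on_affine => [x|v].
  by apply: continuousD; [exact: coord_mulmx_continuous | exact: cst_continuous].
exists ((v *m P) ord0 j) => x t.
by rewrite mulmxDl -scalemxAl !mxE addrA.
Qed.

Lemma local_coordinates_affine (R : realType) (n : nat) (p : 'rV[R]_n)
    (P : 'M[R]_n) :
  P \in unitmx -> local_coordinates p setT (fun x => (x - p) *m P).
Proof.
move=> uP; exists setT, (fun y => y *m invmx P + p).
split; first by split; [exact: openT | | exact: openT].
split; first by rewrite subrr mul0mx.
split; first by move=> x _; rewrite mulmxK // subrK.
split; first by move=> y _; rewrite addrK mulmxKV.
split; last exact: smooth_on_affine.
rewrite (_ : (fun x => _) = fun x => x *m P + - p *m P).
  exact: smooth_on_affine.
by apply/funext => x; rewrite mulmxDl.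
Qed.

Lemma is_diff_coord (R : realType) (m n : nat) (M : 'M[R]_(m, n)) i j :
  is_diff M (fun N : 'M[R]_(m, n) => N i j : R) (fun N => N i j).
Proof.
pose l : 'M[R]_(m, n) -> R := fun N => N i j.
have linl : linear l by move=> k A B; rewrite /l !mxE.
pose lM := GRing.isLinear.Build _ _ _ _ l linl.
pose f : {linear 'M[R]_(m, n) -> R} := HB.pack l lM.
apply: DiffDef; first exact: differentiable_coord.
by rewrite -[LHS]/('d f M : _ -> _) diff_lin //; exact: coord_continuous.
Qed.

Lemma jacobian_row1 (R : realType) (n : nat) (f : 'rV[R]_n -> R)
    (p : 'rV[R]_n) i j :
  differentiable f p ->
  'J (fun x => \row_(k < 1) f x) p i j = 'd f p (delta_mx ord0 i).
Proof.
move=> df.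
(* A scalar function times a fixed vector, so that [diffZl] applies. *)
rewrite (_ : (fun x => _) = fun x => f x *: const_mx 1); last first.
  by apply/funext => x; apply/rowP => k; rewrite !mxE mulr1.
by rewrite !mxE diffZl // !mxE mulr1.
Qed.

(** A single column has rank at most 1. This turns the rank condition for one equation into
    nonvanishing of the gradient. *)
Lemma mxrank_col1 (F : fieldType) (n : nat) (A : 'M[F]_(n, 1)) :
  \rank A = 1%N <-> A <> 0.
Proof.
split=> [rA A0|/eqP]; first by move: rA; rewrite A0 mxrank0.
rewrite -mxrank_eq0 => rA.
by apply/eqP; rewrite eqn_leq rank_leq_col lt0n.
Qed.

Lemma sum_ord4 (V : nmodType) (f : 'I_4 -> V) :
  \sum_i f i = f (@Ordinal 4 0 isT) + f (@Ordinal 4 1 isT)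
             + f (@Ordinal 4 2 isT) + f (@Ordinal 4 3 isT).
Proof.
rewrite !big_ord_recr big_ord0 /= add0r.
by congr (f _ + f _ + f _ + f _); exact: val_inj.
Qed.

Lemma sum_ord5 (V : nmodType) (f : 'I_5 -> V) :
  \sum_i f i = f (@Ordinal 5 0 isT) + f (@Ordinal 5 1 isT)
             + f (@Ordinal 5 2 isT) + f (@Ordinal 5 3 isT)
             + f (@Ordinal 5 4 isT).
Proof.
rewrite !big_ord_recr big_ord0 /= add0r.
by congr (f _ + f _ + f _ + f _ + f _); exact: val_inj.
Qed.

Section TriangleVariety.
Context {R : realType}.
Implicit Type c : 'rV[R]_5.

Lemma is_diff_t12 c :
  is_diff c (@t12 R) (fun v => (a1 c - a12 c) * x1 v + (a12 c - a2 c) * x2 v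
    + x1 c * a1 v - x2 c * a2 v + (x2 c - x1 c) * a12 v).
Proof.
pose D := is_diff_coord c ord0.
rewrite /t12 /x1 /x2 /a1 /a2 /a12.
(* The product rule, to be used once for each of the four monomials of [t12]. *)
pose E i j := is_diffM (D i) (D j).
have := is_diffD (is_diffB (is_diffB (E (@Ordinal 5 2 isT) (@Ordinal 5 0 isT))
  (E (@Ordinal 5 3 isT) (@Ordinal 5 1 isT)))
  (E (@Ordinal 5 4 isT) (@Ordinal 5 0 isT)))
  (E (@Ordinal 5 4 isT) (@Ordinal 5 1 isT)).
move=> /is_diff_eq; apply.
apply/funext => v /=.
rewrite !fctE /GRing.scale /=.
ring.
Qed.

Lemma T3_singularE c : T3 c ->
  T3_singular c <->
    (x0 c = x1 c /\ x1 c = x2 c) /\ (a1 c = a2 c /\ a2 c = a12 c).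
Proof.
move=> hc; have [dt dtE] := is_diff_t12 c.
have JE i : 'J (@T3_equations R) c i ord0 = 'd (@t12 R) c (delta_mx ord0 i).
  exact: jacobian_row1.
(* The required rank 5 - 4 computes to 1. *)
rewrite /T3_singular /nonsingular_point mxrank_col1.
split=> [[_ /contrapT J0]|[[e1 e2] [e3 e4]]].
  move: JE; rewrite J0 dtE => JE.
  (* The first four gradient entries give a_1 = a_12, a_12 = a_2, x_1 = 0 and x_2 = 0; the fifth,
     x_2 - x_1, is a combination of them. *)
  have := JE (@Ordinal 5 0 isT); have := JE (@Ordinal 5 1 isT).
  have := JE (@Ordinal 5 2 isT); have := JE (@Ordinal 5 3 isT).
  rewrite /x1 /x2 /a1 /a2 /a12 /x0 !mxE /= => h3 h2 h1 h0.
  by split; split; lra.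
split=> // nz; apply: nz; apply/matrixP => i j.
rewrite ord1 JE dtE mxE -e3 in e4 *.
rewrite -e4 -e2 -e1 /x0; ring.
Qed.

(* As x |-> x *m slope_shift_mx: fixes x_1, x_2 and a_12 and replaces the slope
   a_i by a_i - a_12. *)
Definition slope_shift_mx : 'M[R]_5 :=
  1%:M - delta_mx (@Ordinal 5 4 isT) (@Ordinal 5 2 isT)
       - delta_mx (@Ordinal 5 4 isT) (@Ordinal 5 3 isT).

(** The matrix is lower triangular with ones on the diagonal. *)
Lemma slope_shift_mx_unit : slope_shift_mx \in unitmx.
Proof.
rewrite unitmxE det_trig; last first.
  by apply/is_trig_mxP => -[[|[|[|[|[|//]]]]] ?] [[|[|[|[|[|//]]]]] ?] //= _;
    rewrite !mxE /= ?subr0.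
by rewrite !big_ord_recl big_ord0 !mxE /= !subr0 !mulr1 unitr1.
Qed.

(** Gram matrix of y_0 y_2 - y_1 y_3, an orthogonal sum of two hyperbolic planes; the factor 1/2
    compensates for each product occurring twice. *)
Definition split_form_mx : 'M[R]_4 :=
  2^-1 *: (delta_mx (@Ordinal 4 0 isT) (@Ordinal 4 2 isT)
         + delta_mx (@Ordinal 4 2 isT) (@Ordinal 4 0 isT)
         - delta_mx (@Ordinal 4 1 isT) (@Ordinal 4 3 isT)
         - delta_mx (@Ordinal 4 3 isT) (@Ordinal 4 1 isT)).

Lemma split_form_mx_sym : split_form_mx^T = split_form_mx.
Proof.
by apply/matrixP => -[[|[|[|[|//]]]] ?] [[|[|[|[|//]]]] ?];
  rewrite !mxE /=; ring.
Qed.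

Lemma split_form_mx_unit : split_form_mx \in unitmx.
Proof.
(* Twice the matrix is a signed permutation matrix of square 1, so the inverse is four times the
   matrix. *)
apply: (proj2 (@mulmx1_unit _ _ (4 *: split_form_mx) _ _)).
apply/matrixP => -[[|[|[|[|//]]]] ?] [[|[|[|[|//]]]] ?];
  rewrite mxE sum_ord4 !mxE /=; by field.
Qed.

Lemma quadratic_split_form (y : 'rV[R]_4) :
  quadratic_form split_form_mx y =
    y ord0 (@Ordinal 4 0 isT) * y ord0 (@Ordinal 4 2 isT)
    - y ord0 (@Ordinal 4 1 isT) * y ord0 (@Ordinal 4 3 isT).
Proof.
rewrite /quadratic_form.
by rewrite mxE sum_ord4 !mxE !sum_ord4 !mxE /=; field.
Qed.

(** Since the slopes of [c] coincide, they cancel in the differences a_i - a_12, and its points are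
    at 0; so centring at [c] leaves the first four new coordinates unchanged. *)
Lemma t12_normal_form c (x : 'rV[R]_5) :
  x0 c = x1 c -> x1 c = x2 c -> a1 c = a2 c -> a2 c = a12 c ->
  t12 x = quadratic_form split_form_mx
            (col' ord_max ((x - c) *m slope_shift_mx)).
Proof.
move=> e1 e2 e3 e4; rewrite quadratic_split_form.
rewrite !mxE !sum_ord5 !mxE /=.
move: e1 e2 e3 e4; rewrite /t12 /x0 /x1 /x2 /a1 /a2 /a12 => e1 e2 e3 <-.
by rewrite e3 -e2 -e1; ring.
Qed.

End TriangleVariety.

Theorem lemma5p52 (R : realType) (c : 'rV[R]_5) (hc : T3 c) :
  (T3_singular c <->
     (x0 c = x1 c /\ x1 c = x2 c) /\ (a1 c = a2 c /\ a2 c = a12 c)) /\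
  (T3_singular c -> A_infty (@t12 R) c).
Proof.
split; first exact: T3_singularE.
move=> /(T3_singularE hc) [[e1 e2] [e3 e4]].
(* The omitted coordinate [ord_max] is the centred a_12, which parametrizes the line of singular
   points. *)
exists setT, (fun x => (x - c) *m slope_shift_mx), ord_max, split_form_mx.
split.
- exact/local_coordinates_affine/slope_shift_mx_unit.
- exact: split_form_mx_sym.
- exact: split_form_mx_unit.
- by move=> x _; exact: t12_normal_form.
Qed.
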